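(* Let $F$ be a Minkowski norm on $\mathbb{R}^2$, let $Q\subset\mathbb{R}^2$ be a bounded strictly convex domain with (piecewise) smooth boundary, and let $\gamma(s)=(\gamma_1(s),\gamma_2(s))$ be the counterclockwise parametrization of $\partial Q$ by $F$-arc-length, $F(\gamma'(s))=1$. Let $\mathcal{T}:(s,u)\mapsto(s_1,u_1)$ be the Minkowski billiard map of $Q$ in the coordinates $(s,u)$ described in the context. Then $\mathcal{T}$ preserves the area form $\omega=ds\wedge du$. Moreover, writing $v=\gamma(s_1)-\gamma(s)$, the entries of the tangent map $$D_{(s,u)}\mathcal{T}=\begin{bmatrix}\frac{\partial s_1}{\partial s}&\frac{\partial s_1}{\partial u}\\ \frac{\partial u_1}{\partial s}&\frac{\partial u_1}{\partial u}\end{bmatrix}$$ are given by $$\frac{\partial s_1}{\partial s}=\frac{\sum_{j,k=1}^2F_{v_jv_k}(v)\gamma_j'(s)\gamma_k'(s)-\sum_{j=1}^2F_{v_j}(v)\gamma_j''(s)}{\sum_{j,k=1}^2F_{v_jv_k}(v)\gamma_j'(s)\gamma_k'(s_1)},$$ $$\frac{\partial s_1}{\partial u}=\frac{-1}{\sum_{j,k=1}^2F_{v_jv_k}(v)\gamma_j'(s)\gamma_k'(s_1)},$$ $$\frac{\partial u_1}{\partial s}=\sum_{j,k=1}^2F_{v_jv_k}(v)\gamma_j'(s_1)\gamma_k'(s)-\left(\sum_{j,k=1}^2F_{v_jv_k}(v)\gamma_j'(s_1)\gamma_k'(s_1)+\sum_{j=1}^2F_{v_j}(v)\gamma_j''(s_1)\right)\left(\frac{\sum_{j,k=1}^2F_{v_jv_k}(v)\gamma_j'(s)\gamma_k'(s)-\sum_{j=1}^2F_{v_j}(v)\gamma_j''(s)}{\sum_{j,k=1}^2F_{v_jv_k}(v)\gamma_j'(s)\gamma_k'(s_1)}\right),$$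 $$\frac{\partial u_1}{\partial u}=\frac{\sum_{j,k=1}^2F_{v_jv_k}(v)\gamma_j'(s_1)\gamma_k'(s_1)+\sum_{j=1}^2F_{v_j}(v)\gamma_j''(s_1)}{\sum_{j,k=1}^2F_{v_jv_k}(v)\gamma_j'(s)\gamma_k'(s_1)}.$$
   Context: A Minkowski norm on $\mathbb{R}^2$ is a function $F:\mathbb{R}^2\to[0,\infty)$ that is $C^\infty$ on $\mathbb{R}^2\setminus\{0\}$, satisfies $F(cv)=cF(v)$ for $c>0$ (it need not satisfy $F(-v)=F(v)$), and for which the Hessian of $\frac12F^2$ is positive definite at every nonzero point. $F_{v_j}$ and $F_{v_jv_k}$ denote first and second partial derivatives of $F$; primes denote derivatives with respect to the parameter $s$. Minkowski billiard. The phase space $\mathcal{M}$ consists of pairs $(x,w)$ with $x\in\partial Q$ and $w$ an $F$-unit vector ($F(w)=1$) based at $x$ pointing into the interior of $Q$. A particle leaves $x=\gamma(s)$ in the direction $w$, moves along a straight line, and hits $\partial Q$ at $\gamma(s_1)$; it is then reflected and next hits $\partial Q$ at $\gamma(s_2)$. Reflection law: the ray $\gamma(s_1)\gamma(s_2)$ is the reflection of $\gamma(s)\gamma(s_1)$ at $\gamma(s_1)$ iff $s_1$ is a critical point of $\sigma\mapsto\ell(s,\sigma)+\ell(\sigma,s_2)$, where $\ell(s,s_1)=F(\gamma(s_1)-\gamma(s))$ is the Minkowski distance from $\gamma(s)$ to $\gamma(s_1)$. The billiard map sends the phase point at $\gamma(s)$ pointing to $\gamma(s_1)$ to the phase point at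 $\gamma(s_1)$ pointing to $\gamma(s_2)$. Coordinates. The phase point at $\gamma(s)$ pointing towards $\gamma(s_1)$ is given the coordinates $(s,u)$ with $u=u(s,s_1):=\frac{\partial\ell}{\partial s}(s,s_1)$. Accordingly its image under the billiard map has coordinates $(s_1,u_1)$ with $u_1=u(s_1,s_2)$, and $\mathcal{T}:(s,u)\mapsto(s_1,u_1)$. When $\partial Q$ is only piecewise smooth, the assertions concern phase points for which $\gamma$ is smooth near $s$ and near $s_1$. *)

(* Defs.v *)
From Stdlib Require Export Reals.
From Coquelicot Require Export Coquelicot.
Open Scope R_scope.

(* The plane is [R * R] with its Coquelicot product structure. *)

(** * Derivatives *)

Definition D1 (f : R * R -> R) (p : R * R) : R :=
  Derive (fun x => f (x, snd p)) (fst p).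

Definition D2 (f : R * R -> R) (p : R * R) : R :=
  Derive (fun y => f (fst p, y)) (snd p).

(* [sum_j f_{v_j}(v) a_j] *)
Definition grad_sum (f : R * R -> R) (v a : R * R) : R :=
  D1 f v * fst a + D2 f v * snd a.

(* [sum_{j,k} f_{v_j v_k}(v) a_j b_k] *)
Definition hess_sum (f : R * R -> R) (v a b : R * R) : R :=
  D1 (D1 f) v * fst a * fst b + D2 (D1 f) v * fst a * snd b
  + D1 (D2 f) v * snd a * fst b + D2 (D2 f) v * snd a * snd b.

(* [n]-th derivative of a plane curve, componentwise *)
Definition curve_deriv (n : nat) (g : R -> R * R) (s : R) : R * R :=
  (Derive_n (fun t => fst (g t)) n s, Derive_n (fun t => snd (g t)) n s).

Definition curve_ex_deriv (n : nat) (g : R -> R * R) (s : R) : Prop :=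
  ex_derive_n (fun t => fst (g t)) n s /\ ex_derive_n (fun t => snd (g t)) n s.

Definition smooth_curve (g : R -> R * R) : Prop :=
  forall n s, curve_ex_deriv n g s.

Definition smooth_near (g : R -> R * R) (s : R) : Prop :=
  locally s (fun t => forall n, curve_ex_deriv n g t).

Definition differentiable_at (T : R * R -> R * R) (p : R * R) : Prop :=
  differentiable_pt (fun x y => fst (T (x, y))) (fst p) (snd p) /\
  differentiable_pt (fun x y => snd (T (x, y))) (fst p) (snd p).

Definition tangent_map (T : R * R -> R * R) (p X : R * R) : R * R :=
  (grad_sum (fun q => fst (T q)) p X, grad_sum (fun q => snd (T q)) p X).

(* [(ds /\ du)(X, Y)] *)
Definition area_form (X Y : R * R) : R :=
  fst X * snd Y - snd X * fst Y.

(* The pullback of [ds /\ du] by [T] equals [ds /\ du] at [p]. *)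
Definition preserves_area_form_at (T : R * R -> R * R) (p : R * R) : Prop :=
  differentiable_at T p /\
  forall X Y : R * R,
    area_form (tangent_map T p X) (tangent_map T p Y) = area_form X Y.

(** * Minkowski norms *)

(* [ex_diff_n f n x y] says that the partial derivatives of [f] up to order [n]
   exist and are continuous at [(x, y)]; for all [n] and all points of the
   punctured plane this is [C^oo]. *)
Record minkowski_norm (F : R * R -> R) : Prop := {
  mn_ge0 : forall v, 0 <= F v;
  mn_smooth : forall (n : nat) (x y : R), (x, y) <> (0, 0) ->
    ex_diff_n (fun x' y' => F (x', y')) n x y;
  mn_homog : forall (c : R) (v : R * R), 0 < c -> F (scal c v) = c * F v;
  mn_hess : forall v a : R * R, v <> (0, 0) -> a <> (0, 0) ->
    0 < hess_sum (fun w => / 2 * (F w) ^ 2) v a a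
}.

(** * The billiard table *)

Definition closure (Q : R * R -> Prop) (x : R * R) : Prop :=
  ~ locally x (fun y => ~ Q y).

Definition boundary (Q : R * R -> Prop) (x : R * R) : Prop :=
  closure Q x /\ ~ locally x Q.

Record strictly_convex_domain (Q : R * R -> Prop) : Prop := {
  scd_nonempty : exists x, Q x;
  scd_open : open Q;
  scd_bounded : exists M : R, forall x : R * R, Q x -> norm x <= M;
  scd_convex : forall (x y : R * R) (t : R),
    closure Q x -> closure Q y -> x <> y -> 0 < t < 1 ->
    Q (plus (scal (1 - t) x) (scal t y))
}.

Definition points_inside (Q : R * R -> Prop) (x w : R * R) : Prop :=
  exists e : R, 0 < e /\ forall t, 0 < t < e -> Q (plus x (scal t w)).

(* On each closed piece [g] coincides with a curve that is smooth on all of [R],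
   so one-sided derivatives of every order exist at the break points.  With
   period [L], the break points may be chosen in any interval [[a, a + L]]. *)
Definition piecewise_smooth_closed (g : R -> R * R) (L : R) : Prop :=
  (forall s, continuous g s) /\
  (forall s, g (s + L) = g s) /\
  exists (n : nat) (t : nat -> R),
    t n = t 0%nat + L /\
    forall i : nat, (i < n)%nat ->
      t i < t (S i) /\
      exists h : R -> R * R, smooth_curve h /\
        forall s, t i <= s <= t (S i) -> g s = h s.

Definition left_normal (w : R * R) : R * R := (- snd w, fst w).

(* [g] is the [L]-periodic parametrization of the boundary; [L] is the Minkowski
   length of the boundary.  Counterclockwise: the domain lies to the left. *)
Record ccw_arclength_boundary (F : R * R -> R) (Q : R * R -> Prop)
    (g : R -> R * R) (L : R) : Prop := {
  cab_pos : 0 < L;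
  cab_smooth : piecewise_smooth_closed g L;
  cab_inj : forall s t, s < t < s + L -> g s <> g t;
  cab_range : forall x, boundary Q x <-> exists s, g s = x;
  cab_unit : forall s, smooth_near g s -> F (curve_deriv 1 g s) = 1;
  cab_ccw : forall s, smooth_near g s ->
    points_inside Q (g s) (left_normal (curve_deriv 1 g s))
}.

(** * The billiard map *)

(* A phase point is a pair (base point, velocity). *)
Definition phase_space (F : R * R -> R) (Q : R * R -> Prop)
    (p : (R * R) * (R * R)) : Prop :=
  boundary Q (fst p) /\ F (snd p) = 1 /\ points_inside Q (fst p) (snd p).

(* [p] is the phase point at [g s] pointing towards [g s1].  The parameter is
   defined modulo [L]; we normalize the next impact by [s < s1 < s + L], which
   lifts the billiard map from the circle [R / L Z] to [R]. *)
Definition phase_point_from_to (F : R * R -> R) (Q : R * R -> Prop)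
    (g : R -> R * R) (L : R) (p : (R * R) * (R * R)) (s s1 : R) : Prop :=
  phase_space F Q p /\ s < s1 < s + L /\ fst p = g s /\
  exists t : R, 0 < t /\ g s1 = plus (fst p) (scal t (snd p)).

Definition ell (F : R * R -> R) (g : R -> R * R) (s s1 : R) : R :=
  F (minus (g s1) (g s)).

Definition reflected (F : R * R -> R) (g : R -> R * R) (s s1 s2 : R) : Prop :=
  is_derive (fun sigma => ell F g s sigma + ell F g sigma s2) s1 0.

Definition u_coord (F : R * R -> R) (g : R -> R * R) (s s1 : R) : R :=
  Derive (fun sigma => ell F g sigma s1) s.

(* [T] is the billiard map in the coordinates [(s, u)], on the phase points for
   which the boundary is smooth near [s] and near [s1]; nothing is required of
   [T] elsewhere. *)
Definition is_billiard_map (F : R * R -> R) (Q : R * R -> Prop)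
    (g : R -> R * R) (L : R) (T : R * R -> R * R) : Prop :=
  forall (p p1 : (R * R) * (R * R)) (s s1 s2 : R),
    smooth_near g s -> smooth_near g s1 ->
    phase_point_from_to F Q g L p s s1 ->
    phase_point_from_to F Q g L p1 s1 s2 ->
    reflected F g s s1 s2 ->
    T (s, u_coord F g s s1) = (s1, u_coord F g s1 s2).

(* Main.v *)
Require Import Defs.
From Stdlib Require Import Lra Ranalysis5.

(** Let [v] be the chord from [g s] to [g t]. The length [ell F g s t] generates
    the billiard map: by the chain rule its derivative in [s] is
    [- chord_out F g s t], which is the coordinate [u], and its derivative in [t]
    is [chord_in F g s t]; the reflection law at [g t] says that the outgoing
    coordinate [u1] is [- chord_in F g s t], whatever the next impact is. So

    - [T (s, - chord_out F g s t) = (t, - chord_in F g s t)]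

    for every chord between smooth points ([billiard_map_value]), and the tangent
    map follows by implicit differentiation of the first coordinate, once
    [- chord_out] is known to have a nonzero derivative in [t]. The Jacobian
    determinant is the ratio of the two mixed second derivatives of [ell], hence
    equal to one since the Hessian is symmetric.

    Three facts make this rigorous.

    - The derivative of [- chord_out] in [t] is
      [- hess_sum F v (g' s) (g' t)]. By Euler's identity the Hessian of [F] at
      [v] has kernel spanned by [v] and is positive on the directions transversal
      to [v], so this number vanishes only if [v] is parallel to [g' s] or to
      [g' t] ([hess_sum_nonzero]); strict convexity of the table forbids it
      ([chord_transversal]).

    - The map [T] is only prescribed at phase points whose image is again a phase
      point, so a reflected chord has to be found for every chord that arrives at
      a smooth point. The intermediate value theorem provides it
      ([reflected_exists]): seen from [g t], the required derivative lies strictly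
      between the values attained by short chords in the two tangent directions,
      because [grad_sum F v w < F w] when [v] and [w] are not parallel
      ([grad_sum_lt]).

    - The first coordinate of [T] is differentiable at the given point. Any
      solution [t'] of [- chord_out F g s' t' = u'] near [t] must be that
      coordinate, and the intermediate value theorem finds one whose
      distance to the value predicted by the differential is at most any given
      proportion of the displacement ([differentiable_pt_lim_implicit]). *)

(** * Differentials of functions of two real variables *)

Lemma differentiable_pt_lim_value (f : R -> R -> R) (x y a b a' b' : R) :
  differentiable_pt_lim f x y a b -> a = a' -> b = b' ->
  differentiable_pt_lim f x y a' b'.
Proof. now intros H <- <-. Qed.

Lemma differentiable_pt_lim_proj2_0 (f : R -> R) (x y l : R) :
  derivable_pt_lim f y l ->
  differentiable_pt_lim (fun _ v => f v) x y 0 l.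
Proof.
  intros H eps.
  destruct (differentiable_pt_lim_proj1_0 f y x l H eps) as [d Hd].
  exists d; intros u v Hu Hv.
  specialize (Hd v u Hv Hu).
  rewrite Rmax_comm.
  now rewrite (Rplus_comm (0 * _)).
Qed.

Lemma differentiable_pt_lim_plus (f h : R -> R -> R) (x y a b c d : R) :
  differentiable_pt_lim f x y a b -> differentiable_pt_lim h x y c d ->
  differentiable_pt_lim (fun u v => f u v + h u v) x y (a + c) (b + d).
Proof.
  intros Hf Hh.
  assert (P : differentiable_pt_lim Rplus (f x y) (h x y) 1 1).
  { intros eps; exists eps; intros u v _ _.
    replace (u + v - (f x y + h x y) - _) with 0 by ring.
    rewrite Rabs_R0; apply Rmult_le_pos;
      [left; apply cond_pos | eapply Rle_trans; [apply Rabs_pos | apply Rmax_l]]. }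
  eapply differentiable_pt_lim_value;
    [exact (differentiable_pt_lim_comp _ _ _ _ _ _ _ _ _ _ _ P Hf Hh) | ring..].
Qed.

Lemma differentiable_pt_lim_mult (f h : R -> R -> R) (x y a b c d : R) :
  differentiable_pt_lim f x y a b -> differentiable_pt_lim h x y c d ->
  differentiable_pt_lim (fun u v => f u v * h u v) x y
    (a * h x y + f x y * c) (b * h x y + f x y * d).
Proof.
  intros Hf Hh.
  assert (P : differentiable_pt_lim Rmult (f x y) (h x y) (h x y) (f x y)).
  { apply filterdiff_differentiable_pt_lim.
    eapply filterdiff_ext_lin.
    - apply (filterdiff_mult (K := R_AbsRing) (F := locally (f x y, h x y))).
      + intros P HP; exact HP.
      + exact Rmult_comm.
    - intros [u v]; unfold plus, mult; simpl; ring. }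
  eapply differentiable_pt_lim_value;
    [exact (differentiable_pt_lim_comp _ _ _ _ _ _ _ _ _ _ _ P Hf Hh) | ring..].
Qed.

Lemma differentiable_pt_lim_opp (f : R -> R -> R) (x y a b : R) :
  differentiable_pt_lim f x y a b ->
  differentiable_pt_lim (fun u v => - f u v) x y (- a) (- b).
Proof.
  intros Hf eps; destruct (Hf eps) as [d Hd]; exists d; intros u v Hu Hv.
  rewrite <- Rabs_Ropp.
  replace (- _) with (f u v - f x y - (a * (u - x) + b * (v - y))) by ring.
  now apply Hd.
Qed.

Lemma differentiable_pt_lim_continuity (f : R -> R -> R) (x y a b : R) :
  differentiable_pt_lim f x y a b -> continuity_2d_pt f x y.
Proof.
  intros H; apply differentiable_continuity_pt; now exists a, b.
Qed.

(** A number that differs from [- b * r] by at most half its size has the sign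
    opposite to that of [b]. *)
Lemma mult_neg_of_linear_approx (b X r : R) :
  b <> 0 -> 0 < r -> - (Rabs b * (r / 2)) <= X + b * r <= Rabs b * (r / 2) ->
  b * X < 0.
Proof.
  intros Hb Hr [H1 H2].
  destruct (Rdichotomy _ _ Hb) as [Hn | Hp].
  - rewrite Rabs_left in H1, H2 by assumption.
    assert (0 < - b * r) by (apply Rmult_lt_0_compat; lra).
    assert (0 < X) by lra; nra.
  - rewrite Rabs_right in H1, H2 by lra.
    assert (0 < b * r) by (apply Rmult_lt_0_compat; lra).
    assert (X < 0) by lra; nra.
Qed.

(** Implicit function theorem at a single point. The equation [U s' t = u'] is
    solved by the intermediate value theorem around the value of [t] that the
    differential of [U] predicts, within an error that is a given proportion of
    the displacement; since [phi] returns every such solution, this estimate is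
    the differentiability of [phi]. *)
Lemma differentiable_pt_lim_implicit (U phi : R -> R -> R) (s t a b : R) :
  differentiable_pt_lim U s t a b -> b <> 0 ->
  locally_2d (fun s' t' => continuity_pt (U s') t' /\ phi s' (U s' t') = t') s t ->
  differentiable_pt_lim phi s (U s t) (- a / b) (/ b) /\
  locally_2d (fun s' u' => U s' (phi s' u') = u') s (U s t).
Proof.
  intros HU Hb [d0 H0].
  set (u := U s t).
  assert (Hb' : 0 < Rabs b) by now apply Rabs_pos_lt.
  assert (Key : forall eps : posreal, locally_2d (fun s' u' =>
    exists t', Rabs (t' - t - (- a / b * (s' - s) + / b * (u' - u)))
                 <= eps * Rmax (Rabs (s' - s)) (Rabs (u' - u)) /\
               U s' t' = u' /\ phi s' u' = t') s u).
  { intros eps.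
    (* the solutions looked for lie within [C * M] of [t], where [M] is the
       displacement of [(s', u')] *)
    set (C := Rabs a / Rabs b + / Rabs b + eps + 1).
    assert (HCa : 0 <= Rabs a / Rabs b)
      by (apply Rdiv_le_0_compat; [apply Rabs_pos | assumption]).
    assert (HCb : 0 < / Rabs b) by now apply Rinv_0_lt_compat.
    assert (He : 0 < eps) by apply cond_pos.
    assert (HC : 1 < C) by (unfold C; lra).
    assert (Hep : 0 < Rabs b * eps / (2 * C))
      by (apply Rdiv_lt_0_compat; [apply Rmult_lt_0_compat |]; lra).
    destruct (HU (mkposreal _ Hep)) as [d1 H1]; simpl in H1.
    assert (Hd : 0 < Rmin d0 d1 / C)
      by (apply Rdiv_lt_0_compat; [apply Rmin_pos; apply cond_pos | lra]).
    exists (mkposreal _ Hd); simpl; intros s' u' Hs' Hu'.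
    set (M := Rmax (Rabs (s' - s)) (Rabs (u' - u))).
    assert (HMs : Rabs (s' - s) <= M) by apply Rmax_l.
    assert (HMu : Rabs (u' - u) <= M) by apply Rmax_r.
    assert (HM : M < Rmin d0 d1 / C) by now apply Rmax_lub_lt.
    assert (HM0 : 0 <= M) by (eapply Rle_trans; [apply Rabs_pos | exact HMs]).
    assert (HMC : M * C < Rmin d0 d1).
    { apply (Rmult_lt_compat_r C) in HM; [| lra].
      unfold Rdiv in HM; rewrite Rmult_assoc, Rinv_l in HM; lra. }
    assert (HMd : M < Rmin d0 d1) by nra.
    assert (Hm0 := Rmin_l d0 d1). assert (Hm1 := Rmin_r d0 d1).
    set (tau := t + (- a / b * (s' - s) + / b * (u' - u))).
    assert (Htau : Rabs (tau - t) <= (C - eps - 1) * M).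
    { unfold tau.
      replace (t + _ - t) with (- a / b * (s' - s) + / b * (u' - u)) by ring.
      eapply Rle_trans; [apply Rabs_triang |].
      rewrite !Rabs_mult, Rabs_inv.
      unfold Rdiv; rewrite Rabs_mult, Rabs_Ropp, Rabs_inv.
      fold (Rabs a / Rabs b).
      replace (C - eps - 1) with (Rabs a / Rabs b + / Rabs b) by (unfold C; ring).
      rewrite Rmult_plus_distr_r.
      apply Rplus_le_compat; apply Rmult_le_compat_l; lra. }
    assert (Hnear : forall t', Rabs (t' - tau) <= eps * M -> Rabs (t' - t) <= C * M).
    { intros t' Ht'.
      replace (t' - t) with ((t' - tau) + (tau - t)) by ring.
      eapply Rle_trans; [apply Rabs_triang |]; nra. }
    assert (Herr : forall t', Rabs (t' - tau) <= eps * M ->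
      Rabs (U s' t' - u' - b * (t' - tau)) <= Rabs b * eps / 2 * M).
    { intros t' Ht'.
      assert (Hn := Hnear t' Ht').
      assert (H := H1 s' t' ltac:(lra) ltac:(nra)).
      replace (U s' t' - u' - b * (t' - tau)) with
        (U s' t' - U s t - (a * (s' - s) + b * (t' - t)))
        by (unfold tau, u; field; assumption).
      eapply Rle_trans; [exact H |].
      replace (Rabs b * eps / 2 * M) with (Rabs b * eps / (2 * C) * (C * M))
        by (field; lra).
      apply Rmult_le_compat_l; [lra |].
      apply Rmax_lub; [nra | exact Hn]. }
    assert (Hsol : exists t', Rabs (t' - tau) <= eps * M /\ U s' t' = u').
    { destruct (Rle_lt_or_eq_dec _ _ HM0) as [HMp | HMz].
      2:{ assert (E : Rabs (tau - tau) <= eps * M)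
            by (rewrite <- HMz, Rminus_diag, Rabs_R0; lra).
          exists tau; split; [exact E |].
          assert (H := Herr tau E); rewrite <- HMz in H.
          apply Rminus_diag_uniq.
          destruct (Req_dec (U s' tau - u') 0) as [Z | Z]; [exact Z |].
          apply Rabs_pos_lt in Z.
          replace (U s' tau - u' - b * (tau - tau)) with (U s' tau - u') in H by ring.
          lra. }
      set (r := eps * M).
      assert (Hr : 0 < r) by (unfold r; nra).
      (* multiplying by [b] makes the difference increase across the interval *)
      destruct (IVT_interv (fun t' => b * (U s' t' - u')) (tau - r) (tau + r))
        as [z [Hz Ez]].
      - intros t' Ht'.
        apply continuity_pt_scal, continuity_pt_minus.
        + assert (Ht : Rabs (t' - tau) <= eps * M) by (apply Rabs_le; fold r; lra).
          assert (Hn := Hnear _ Ht).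
          apply H0; nra.
        + apply continuity_pt_const; red; reflexivity.
      - lra.
      - assert (H := Herr (tau - r)).
        replace (tau - r - tau) with (- r) in H by ring.
        rewrite Rabs_Ropp, (Rabs_pos_eq r) in H by lra.
        specialize (H (Rle_refl _)).
        replace (Rabs b * eps / 2 * M) with (Rabs b * (r / 2)) in H
          by (unfold r; field).
        apply Rabs_le_between in H; set (X := U s' (tau - r) - u') in *.
        apply (mult_neg_of_linear_approx b X r); [assumption | exact Hr | lra].
      - assert (H := Herr (tau + r)).
        replace (tau + r - tau) with r in H by ring.
        rewrite (Rabs_pos_eq r) in H by lra.
        specialize (H (Rle_refl _)).
        replace (Rabs b * eps / 2 * M) with (Rabs b * (r / 2)) in H
          by (unfold r; field).
        apply Rabs_le_between in H; set (X := U s' (tau + r) - u') in *.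
        assert (b * - X < 0)
          by (apply (mult_neg_of_linear_approx b (- X) r); [assumption | exact Hr | lra]).
        lra.
      - exists z; split; [apply Rabs_le; fold r; lra |].
        apply Rmult_integral in Ez; lra. }
    destruct Hsol as [t' [Ht' Et']].
    exists t'; repeat split; [| exact Et' |].
    - replace (t' - t - _) with (t' - tau) by (unfold tau; ring); exact Ht'.
    - rewrite <- Et'; apply H0; [lra |].
      assert (H := Hnear _ Ht'); nra. }
  assert (Hphi : phi s u = t).
  { destruct (H0 s t) as [_ E];
      [rewrite Rminus_diag, Rabs_R0; apply cond_pos.. | exact E]. }
  split.
  - intros eps; destruct (Key eps) as [d Hd]; exists d; intros s' u' Hs' Hu'.
    destruct (Hd s' u' Hs' Hu') as [t' [Ht' [_ Et']]].
    fold u; rewrite Et', Hphi; exact Ht'.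
  - destruct (Key (mkposreal 1 Rlt_0_1)) as [d Hd]; exists d; intros s' u' Hs' Hu'.
    destruct (Hd s' u' Hs' Hu') as [t' [_ [Et' E]]].
    now rewrite E.
Qed.

(** * Calculus on the punctured plane *)

Lemma is_derive_Rmult (f h : R -> R) (x a b : R) :
  is_derive f x a -> is_derive h x b ->
  is_derive (fun z => f z * h z) x (a * h x + f x * b).
Proof.
  rewrite !is_derive_Reals; apply derivable_pt_lim_mult.
Qed.

Lemma is_derive_Rplus (f h : R -> R) (x a b : R) :
  is_derive f x a -> is_derive h x b ->
  is_derive (fun z => f z + h z) x (a + b).
Proof.
  rewrite !is_derive_Reals; apply derivable_pt_lim_plus.
Qed.

(** [f] is of class [C^oo] away from the origin. *)
Definition smooth_off_origin (f : R * R -> R) : Prop :=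
  forall (n : nat) (x y : R), (x, y) <> (0, 0) ->
    ex_diff_n (fun x' y' => f (x', y')) n x y.

Lemma locally_2d_nonzero (x y : R) :
  (x, y) <> (0, 0) -> locally_2d (fun u v => (u, v) <> (0, 0)) x y.
Proof.
  intros H.
  assert (Hn : 0 < Rmax (Rabs x) (Rabs y)).
  { destruct (Req_dec x 0) as [-> | Hx].
    - destruct (Req_dec y 0) as [-> | Hy]; [now elim H |].
      apply Rlt_le_trans with (Rabs y); [now apply Rabs_pos_lt | apply Rmax_r].
    - apply Rlt_le_trans with (Rabs x); [now apply Rabs_pos_lt | apply Rmax_l]. }
  exists (mkposreal _ Hn); simpl; intros u v Hu Hv E.
  injection E as -> ->.
  rewrite Rminus_0_l, Rabs_Ropp in Hu, Hv.
  revert Hu Hv; apply Rmax_case; lra.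
Qed.

Section SmoothOffOrigin.

Variable f : R * R -> R.
Hypothesis Hf : smooth_off_origin f.

Lemma smooth_off_origin_D1 : smooth_off_origin (D1 f).
Proof. intros n x y H; apply (Hf (S n) x y H). Qed.

Lemma smooth_off_origin_D2 : smooth_off_origin (D2 f).
Proof. intros n x y H; apply (Hf (S n) x y H). Qed.

Lemma smooth_off_origin_derive1 (x y : R) :
  (x, y) <> (0, 0) -> is_derive (fun z => f (z, y)) x (D1 f (x, y)).
Proof. intros H; apply Derive_correct, (Hf 1%nat x y H). Qed.

Lemma smooth_off_origin_derive2 (x y : R) :
  (x, y) <> (0, 0) -> is_derive (fun z => f (x, z)) y (D2 f (x, y)).
Proof. intros H; apply Derive_correct, (Hf 1%nat x y H). Qed.

Lemma smooth_off_origin_differentiable (v : R * R) :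
  v <> (0, 0) ->
  differentiable_pt_lim (fun x y => f (x, y)) (fst v) (snd v) (D1 f v) (D2 f v).
Proof.
  destruct v as [x y]; intros H; simpl.
  apply filterdiff_differentiable_pt_lim.
  apply (is_derive_filterdiff (fun x y => f (x, y)) x y
           (fun u v => D1 f (u, v)) (D2 f (x, y))).
  - apply (proj1 (locally_2d_locally
      (fun u v => is_derive (fun z => f (z, v)) u (D1 f (u, v))) x y)).
    destruct (locally_2d_nonzero x y H) as [d Hd]; exists d; intros u v Hu Hv.
    now apply smooth_off_origin_derive1, Hd.
  - now apply smooth_off_origin_derive2.
  - apply (proj1 (continuity_2d_pt_filterlim (fun u v => D1 f (u, v)) x y)).
    apply (Hf 1%nat x y H).
Qed.

Lemma smooth_off_origin_Schwarz (v : R * R) :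
  v <> (0, 0) -> D1 (D2 f) v = D2 (D1 f) v.
Proof.
  destruct v as [x y]; intros H.
  apply (Schwarz (fun x y => f (x, y)) x y).
  - destruct (locally_2d_nonzero x y H) as [d Hd]; exists d; intros u v Hu Hv.
    destruct (Hf 2%nat u v (Hd u v Hu Hv)) as [_ [E1 [E2 [E3 E4]]]].
    now split; [| split; [| split; [apply E4 | apply E3]]].
  - apply (Hf 2%nat x y H).
  - apply (Hf 2%nat x y H).
Qed.

Lemma is_derive_comp_curve (c : R -> R * R) (c' : R * R) (t : R) :
  c t <> (0, 0) ->
  is_derive (fun r => fst (c r)) t (fst c') ->
  is_derive (fun r => snd (c r)) t (snd c') ->
  is_derive (fun r => f (c r)) t (grad_sum f (c t) c').
Proof.
  intros H H1 H2.
  apply is_derive_ext with (fun r => f (fst (c r), snd (c r))).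
  { intros r; now rewrite <- surjective_pairing. }
  apply is_derive_Reals.
  apply (derivable_pt_lim_comp_2d (fun x y => f (x, y))
           (fun r => fst (c r)) (fun r => snd (c r))).
  - now apply smooth_off_origin_differentiable.
  - now apply is_derive_Reals.
  - now apply is_derive_Reals.
Qed.

End SmoothOffOrigin.

Lemma grad_sum_scal (f : R * R -> R) (v a : R * R) (c : R) :
  grad_sum f v (c * fst a, c * snd a) = c * grad_sum f v a.
Proof. unfold grad_sum; simpl; ring. Qed.

Lemma is_derive_grad_sum_line (f : R * R -> R) (v d b : R * R) (t : R) :
  smooth_off_origin f ->
  (fst v + t * fst d, snd v + t * snd d) <> (0, 0) ->
  is_derive (fun r => grad_sum f (fst v + r * fst d, snd v + r * snd d) b) t
    (hess_sum f (fst v + t * fst d, snd v + t * snd d) b d).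
Proof.
  intros Hf H.
  set (c := fun r : R => (fst v + r * fst d, snd v + r * snd d)).
  assert (C1 : is_derive (fun r => fst (c r)) t (fst d))
    by (unfold c; simpl; auto_derive; [trivial | ring]).
  assert (C2 : is_derive (fun r => snd (c r)) t (snd d))
    by (unfold c; simpl; auto_derive; [trivial | ring]).
  assert (K1 := is_derive_comp_curve _ (smooth_off_origin_D1 f Hf) c d t H C1 C2).
  assert (K2 := is_derive_comp_curve _ (smooth_off_origin_D2 f Hf) c d t H C1 C2).
  unfold grad_sum at 1.
  evar_last.
  - apply @is_derive_plus; apply @is_derive_scal_l; [exact K1 | exact K2].
  - unfold plus, scal, c; simpl; unfold mult; simpl.
    unfold hess_sum, grad_sum; ring.
Qed.

(** * Minkowski norms *)

Section Minkowski.

Variable F : R * R -> R.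
Hypothesis HF : minkowski_norm F.

Let HFs : smooth_off_origin F := mn_smooth F HF.

Lemma minkowski_norm_scal (c x y : R) : 0 < c -> F (c * x, c * y) = c * F (x, y).
Proof. exact (mn_homog F HF c (x, y)). Qed.

Lemma minkowski_norm_0 : F (0, 0) = 0.
Proof.
  assert (H := minkowski_norm_scal 2 0 0 ltac:(lra)).
  rewrite Rmult_0_r in H; lra.
Qed.

(** Euler's identity for a positively homogeneous function of degree one. *)
Lemma minkowski_norm_euler (v : R * R) : v <> (0, 0) -> grad_sum F v v = F v.
Proof.
  intros H.
  assert (H1 : (1 * fst v, 1 * snd v) = v)
    by (rewrite !Rmult_1_l; now destruct v).
  assert (K : is_derive (fun r => F (r * fst v, r * snd v)) 1 (grad_sum F v v)).
  { set (c := fun r : R => (r * fst v, r * snd v)).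
    replace (grad_sum F v v) with (grad_sum F (c 1) v) by (unfold c; now rewrite H1).
    apply (is_derive_comp_curve F HFs c v 1); unfold c; simpl.
    - now rewrite H1.
    - auto_derive; [trivial | ring].
    - auto_derive; [trivial | ring]. }
  apply is_derive_unique in K; rewrite <- K.
  apply is_derive_unique.
  apply is_derive_ext_loc with (fun r => r * F v).
  - exists (mkposreal 1 Rlt_0_1); intros r Hr.
    unfold ball in Hr; simpl in Hr; unfold AbsRing_ball, abs, minus, plus, opp in Hr.
    simpl in Hr; apply Rabs_def2 in Hr.
    rewrite minkowski_norm_scal by lra; now destruct v.
  - auto_derive; [trivial | ring].
Qed.

(** The partial derivatives of [F] are homogeneous of degree zero. *)
Lemma grad_sum_homog (c : R) (v b : R * R) : 0 < c -> v <> (0, 0) ->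
  grad_sum F (c * fst v, c * snd v) b = grad_sum F v b.
Proof.
  intros Hc Hv.
  assert (Hcv : (c * fst v, c * snd v) <> (0, 0)).
  { intros E; injection E as E1 E2; apply Hv.
    apply Rmult_integral in E1; apply Rmult_integral in E2.
    destruct v; simpl in *; f_equal; lra. }
  set (l := fun r : R => (fst v + r * fst b, snd v + r * snd b)).
  set (lc := fun r : R => (c * fst (l r), c * snd (l r))).
  assert (l0 : l 0 = v) by (unfold l; rewrite !Rmult_0_l, !Rplus_0_r; now destruct v).
  assert (lc0 : lc 0 = (c * fst v, c * snd v)) by (unfold lc; now rewrite l0).
  assert (K : is_derive (fun r => F (l r)) 0 (grad_sum F (l 0) b)).
  { apply (is_derive_comp_curve F HFs); [now rewrite l0 | |];
      unfold l; simpl; auto_derive; trivial; ring. }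
  assert (Kc : is_derive (fun r => F (lc r)) 0
                 (grad_sum F (lc 0) (c * fst b, c * snd b))).
  { apply (is_derive_comp_curve F HFs); [now rewrite lc0 | |];
      unfold lc, l; simpl; auto_derive; trivial; ring. }
  assert (E : c * grad_sum F v b = c * grad_sum F (c * fst v, c * snd v) b).
  { rewrite <- (grad_sum_scal F (c * fst v, c * snd v)), <- lc0.
    rewrite <- (is_derive_unique _ _ _ Kc).
    symmetry; apply is_derive_unique.
    apply is_derive_ext with (fun r => c * F (l r)).
    - intros r; unfold lc; rewrite minkowski_norm_scal by exact Hc.
      now rewrite <- surjective_pairing.
    - rewrite <- l0; now apply is_derive_scal. }
  symmetry; apply Rmult_eq_reg_l with c; [exact E | lra].
Qed.

Lemma continuity_2d_grad_sum (v b : R * R) : v <> (0, 0) ->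
  continuity_2d_pt (fun x y => grad_sum F (x, y) b) (fst v) (snd v).
Proof.
  intros Hv; unfold grad_sum.
  apply continuity_2d_pt_plus; apply continuity_2d_pt_mult;
    try apply continuity_2d_pt_const; eapply differentiable_pt_lim_continuity.
  - apply (smooth_off_origin_differentiable _ (smooth_off_origin_D1 F HFs) v Hv).
  - apply (smooth_off_origin_differentiable _ (smooth_off_origin_D2 F HFs) v Hv).
Qed.

(** The gradient of [F] along a short chord of a regular curve tends to the
    gradient of [F] along the tangent [a]. *)
Lemma grad_sum_short_chord (c : R -> R * R) (a b : R * R) (eps : R) :
  is_derive (fun r => fst (c r)) 0 (fst a) ->
  is_derive (fun r => snd (c r)) 0 (snd a) ->
  a <> (0, 0) -> 0 < eps ->
  exists d : posreal, forall h, 0 < h < d ->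
    Rabs (grad_sum F (fst (c h) - fst (c 0), snd (c h) - snd (c 0)) b
          - grad_sum F a b) < eps.
Proof.
  intros H1 H2 Ha He.
  destruct (locally_2d_nonzero (fst a) (snd a)) as [d0 D0];
    [now rewrite <- surjective_pairing |].
  destruct (continuity_2d_grad_sum a b Ha (mkposreal eps He)) as [d3 D3].
  simpl in D3; rewrite <- surjective_pairing in D3.
  assert (Hd : 0 < Rmin d0 d3) by (apply Rmin_pos; apply cond_pos).
  destruct (proj1 (is_derive_Reals _ _ _) H1 _ Hd) as [d1 N1].
  destruct (proj1 (is_derive_Reals _ _ _) H2 _ Hd) as [d2 N2].
  assert (Hd' : 0 < Rmin d1 d2) by (apply Rmin_pos; apply cond_pos).
  exists (mkposreal _ Hd'); simpl; intros h [Hh0 Hh].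
  assert (Hh1 := Rmin_l d1 d2). assert (Hh2 := Rmin_r d1 d2).
  assert (Hm1 := Rmin_l d0 d3). assert (Hm2 := Rmin_r d0 d3).
  assert (Q1 := N1 h ltac:(lra) ltac:(rewrite Rabs_pos_eq; lra)).
  assert (Q2 := N2 h ltac:(lra) ltac:(rewrite Rabs_pos_eq; lra)).
  rewrite Rplus_0_l in Q1, Q2.
  set (q1 := (fst (c h) - fst (c 0)) / h) in *.
  set (q2 := (snd (c h) - snd (c 0)) / h) in *.
  replace (fst (c h) - fst (c 0)) with (h * fst (q1, q2))
    by (simpl; unfold q1; field; lra).
  replace (snd (c h) - snd (c 0)) with (h * snd (q1, q2))
    by (simpl; unfold q2; field; lra).
  rewrite grad_sum_homog; [apply D3; lra | exact Hh0 | apply D0; lra].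
Qed.

Lemma hess_sum_sym (v a b : R * R) :
  v <> (0, 0) -> hess_sum F v a b = hess_sum F v b a.
Proof.
  intros H; unfold hess_sum.
  rewrite (smooth_off_origin_Schwarz F HFs v H); ring.
Qed.

(** Differentiating Euler's identity: the Hessian of [F] at [v] has [v] in its
    kernel. *)
Lemma hess_sum_kernel (v a : R * R) : v <> (0, 0) -> hess_sum F v a v = 0.
Proof.
  destruct v as [x y]; intros H.
  assert (E1 : x * D1 (D1 F) (x, y) + y * D1 (D2 F) (x, y) = 0).
  { assert (K : is_derive (fun z => F (z, y)) x
      (D1 F (x, y) + (x * D1 (D1 F) (x, y) + y * D1 (D2 F) (x, y)))).
    { apply is_derive_ext_loc with
        (fun z => z * D1 F (z, y) + y * D2 F (z, y)).
      - destruct (locally_2d_nonzero x y H) as [d Hd].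
        exists d; intros z Hz.
        rewrite <- minkowski_norm_euler; [unfold grad_sum; simpl; ring |].
        apply Hd; [exact Hz | rewrite Rminus_diag, Rabs_R0; apply cond_pos].
      - evar_last.
        + apply (is_derive_Rplus (fun z => z * D1 F (z, y)) (fun z => y * D2 F (z, y))).
          * apply (is_derive_Rmult (fun z => z) (fun z => D1 F (z, y)));
              [apply @is_derive_id |].
            apply (smooth_off_origin_derive1 _ (smooth_off_origin_D1 F HFs)), H.
          * apply is_derive_scal.
            apply (smooth_off_origin_derive1 _ (smooth_off_origin_D2 F HFs)), H.
        + unfold one; simpl; ring. }
    assert (K' : D1 F (x, y) = _) by exact (is_derive_unique _ _ _ K); lra. }
  assert (E2 : x * D2 (D1 F) (x, y) + y * D2 (D2 F) (x, y) = 0).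
  { assert (K : is_derive (fun z => F (x, z)) y
      (D2 F (x, y) + (x * D2 (D1 F) (x, y) + y * D2 (D2 F) (x, y)))).
    { apply is_derive_ext_loc with
        (fun z => x * D1 F (x, z) + z * D2 F (x, z)).
      - destruct (locally_2d_nonzero x y H) as [d Hd].
        exists d; intros z Hz.
        rewrite <- minkowski_norm_euler; [unfold grad_sum; simpl; ring |].
        apply Hd; [rewrite Rminus_diag, Rabs_R0; apply cond_pos | exact Hz].
      - evar_last.
        + apply (is_derive_Rplus (fun z => x * D1 F (x, z)) (fun z => z * D2 F (x, z))).
          * apply is_derive_scal.
            apply (smooth_off_origin_derive2 _ (smooth_off_origin_D1 F HFs)), H.
          * apply (is_derive_Rmult (fun z => z) (fun z => D2 F (x, z)));
              [apply @is_derive_id |].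
            apply (smooth_off_origin_derive2 _ (smooth_off_origin_D2 F HFs)), H.
        + unfold one; simpl; ring. }
    assert (K' : D2 F (x, y) = _) by exact (is_derive_unique _ _ _ K); lra. }
  unfold hess_sum; simpl.
  rewrite (smooth_off_origin_Schwarz F HFs _ H) in *.
  transitivity (fst a * (x * D1 (D1 F) (x, y) + y * D2 (D1 F) (x, y))
    + snd a * (x * D2 (D1 F) (x, y) + y * D2 (D2 F) (x, y))); [ring |].
  rewrite E1, E2; ring.
Qed.

(** Away from the origin, the Hessian of [F ^ 2 / 2] is the sum of the square of
    the gradient of [F] and of [F] times its Hessian. *)
Lemma hess_sum_half_sqr (v a : R * R) : v <> (0, 0) ->
  hess_sum (fun w => / 2 * F w ^ 2) v a a =
  grad_sum F v a ^ 2 + F v * hess_sum F v a a.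
Proof.
  destruct v as [x y]; intros H.
  assert (G1 : forall u w, (u, w) <> (0, 0) ->
    D1 (fun w => / 2 * F w ^ 2) (u, w) = F (u, w) * D1 F (u, w)).
  { intros u w Hn; apply is_derive_unique; simpl fst; simpl snd.
    assert (K := smooth_off_origin_derive1 F HFs u w Hn).
    evar_last; [apply is_derive_scal, is_derive_pow; exact K | simpl; field]. }
  assert (G2 : forall u w, (u, w) <> (0, 0) ->
    D2 (fun w => / 2 * F w ^ 2) (u, w) = F (u, w) * D2 F (u, w)).
  { intros u w Hn; apply is_derive_unique; simpl fst; simpl snd.
    assert (K := smooth_off_origin_derive2 F HFs u w Hn).
    evar_last; [apply is_derive_scal, is_derive_pow; exact K | simpl; field]. }
  destruct (locally_2d_nonzero x y H) as [d Hd].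
  assert (R0 : forall z : R, Rabs (z - z) < d)
    by (intros z; rewrite Rminus_diag, Rabs_R0; apply cond_pos).
  assert (M1 : forall g h : R * R -> R, smooth_off_origin h ->
    (forall u w, (u, w) <> (0, 0) -> g (u, w) = F (u, w) * h (u, w)) ->
    D1 g (x, y) = D1 F (x, y) * h (x, y) + F (x, y) * D1 h (x, y)).
  { intros g h Hh E; apply is_derive_unique; simpl fst; simpl snd.
    apply is_derive_ext_loc with (fun z => F (z, y) * h (z, y)).
    - exists d; intros z Hz; symmetry; apply E, Hd; [exact Hz | apply R0].
    - apply (is_derive_Rmult (fun z => F (z, y)) (fun z => h (z, y)));
        now apply smooth_off_origin_derive1. }
  assert (M2 : forall g h : R * R -> R, smooth_off_origin h ->
    (forall u w, (u, w) <> (0, 0) -> g (u, w) = F (u, w) * h (u, w)) ->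
    D2 g (x, y) = D2 F (x, y) * h (x, y) + F (x, y) * D2 h (x, y)).
  { intros g h Hh E; apply is_derive_unique; simpl fst; simpl snd.
    apply is_derive_ext_loc with (fun z => F (x, z) * h (x, z)).
    - exists d; intros z Hz; symmetry; apply E, Hd; [apply R0 | exact Hz].
    - apply (is_derive_Rmult (fun z => F (x, z)) (fun z => h (x, z)));
        now apply smooth_off_origin_derive2. }
  unfold hess_sum.
  rewrite (M1 _ _ (smooth_off_origin_D1 F HFs) G1),
    (M2 _ _ (smooth_off_origin_D1 F HFs) G1),
    (M1 _ _ (smooth_off_origin_D2 F HFs) G2),
    (M2 _ _ (smooth_off_origin_D2 F HFs) G2).
  unfold grad_sum; ring.
Qed.

Lemma minkowski_norm_pos (v : R * R) : v <> (0, 0) -> 0 < F v.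
Proof.
  intros H.
  destruct (mn_ge0 F HF v) as [Hp | Hz]; [exact Hp | exfalso].
  assert (K := mn_hess F HF v v H H).
  rewrite (hess_sum_half_sqr v v H), (minkowski_norm_euler v H), <- Hz in K; lra.
Qed.

Lemma area_form_nonzero_l (v a : R * R) : area_form v a <> 0 -> v <> (0, 0).
Proof. intros H ->; apply H; unfold area_form; simpl; ring. Qed.

(** The Hessian of [F] at [v] is positive on directions transversal to [v]:
    subtracting a multiple of [v] kills the gradient term in the Hessian of
    [F ^ 2 / 2]. *)
Lemma hess_sum_pos (v a : R * R) : area_form v a <> 0 -> 0 < hess_sum F v a a.
Proof.
  intros Hva.
  assert (Hv := area_form_nonzero_l v a Hva).
  assert (HFv := minkowski_norm_pos v Hv).
  set (c := grad_sum F v a / F v).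
  set (b := (fst a - c * fst v, snd a - c * snd v)).
  assert (Hb : b <> (0, 0)).
  { intros E; apply Hva; injection E as E1 E2; unfold area_form.
    replace (fst a) with (c * fst v) by lra.
    replace (snd a) with (c * snd v) by lra; ring. }
  assert (K := mn_hess F HF v b Hv Hb).
  rewrite (hess_sum_half_sqr v b Hv) in K.
  assert (G : grad_sum F v b = 0).
  { transitivity (grad_sum F v a - c * grad_sum F v v);
      [unfold grad_sum, b; simpl; ring |].
    rewrite (minkowski_norm_euler v Hv); unfold c; field; lra. }
  assert (E : hess_sum F v b b = hess_sum F v a a).
  { transitivity (hess_sum F v a a - c * hess_sum F v a v - c * hess_sum F v v a
      + c * c * hess_sum F v v v); [unfold hess_sum, b; simpl; ring |].
    rewrite (hess_sum_sym v v a Hv), !(hess_sum_kernel v _ Hv); ring. }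
  rewrite G, E in K.
  apply Rmult_lt_reg_l with (F v); [exact HFv |]; lra.
Qed.

Lemma hess_sum_nonzero (v a b : R * R) :
  area_form v a <> 0 -> area_form v b <> 0 -> hess_sum F v a b <> 0.
Proof.
  intros Ha Hb.
  assert (Hv := area_form_nonzero_l v a Ha).
  assert (Haa := hess_sum_pos v a Ha).
  (* [b = k a + l v], by Cramer's rule in the basis [v], [a] *)
  set (k := area_form v b / area_form v a).
  set (l := area_form b a / area_form v a).
  assert (E : hess_sum F v a b = k * hess_sum F v a a + l * hess_sum F v a v).
  { assert (E1 : fst b = k * fst a + l * fst v)
      by (unfold k, l, area_form in *; field; assumption).
    assert (E2 : snd b = k * snd a + l * snd v)
      by (unfold k, l, area_form in *; field; assumption).
    unfold hess_sum; rewrite E1, E2; ring. }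
  rewrite E, (hess_sum_kernel v a Hv), Rmult_0_r, Rplus_0_r.
  apply Rmult_integral_contrapositive; split; [| lra].
  unfold k; apply Rmult_integral_contrapositive; split; [exact Hb |].
  now apply Rinv_neq_0_compat.
Qed.

(** Strict convexity of [F] across rays. *)
Lemma grad_sum_lt (v w : R * R) : area_form v w <> 0 -> grad_sum F v w < F w.
Proof.
  intros H.
  assert (Hv := area_form_nonzero_l v w H).
  set (d := (fst w - fst v, snd w - snd v)).
  set (c := fun r : R => (fst v + r * fst d, snd v + r * snd d)).
  assert (Hcd : forall r, area_form (c r) d = area_form v w)
    by (intros r; unfold area_form, c, d; simpl; ring).
  assert (Hc : forall r, c r <> (0, 0))
    by (intros r; apply (area_form_nonzero_l _ d); now rewrite Hcd).
  assert (K1 : forall r, is_derive (fun r => F (c r)) r (grad_sum F (c r) d)).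
  { intros r; apply (is_derive_comp_curve F HFs); [apply Hc | |];
      unfold c, d; simpl; auto_derive; trivial; ring. }
  assert (K2 : forall r, is_derive (fun r => grad_sum F (c r) d) r
                           (hess_sum F (c r) d d))
    by (intros r; apply (is_derive_grad_sum_line F v d d r HFs (Hc r))).
  destruct (MVT_cor2 (fun r => F (c r)) (fun r => grad_sum F (c r) d) 0 1 Rlt_0_1)
    as [x [Ex Hx]].
  { intros r _; apply is_derive_Reals, K1. }
  destruct (MVT_cor2 (fun r => grad_sum F (c r) d)
              (fun r => hess_sum F (c r) d d) 0 x) as [y [Ey Hy]].
  { apply Hx. }
  { intros r _; apply is_derive_Reals, K2. }
  assert (P : 0 < hess_sum F (c y) d d)
    by (apply hess_sum_pos; now rewrite Hcd).
  assert (c0 : c 0 = v) by (unfold c; rewrite !Rmult_0_l, !Rplus_0_r; now destruct v).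
  assert (c1 : c 1 = w)
    by (unfold c, d; destruct v, w; simpl; f_equal; ring).
  assert (HE : grad_sum F v d = grad_sum F v w - F v).
  { rewrite <- (minkowski_norm_euler v Hv) at 1; unfold grad_sum, d; simpl; ring. }
  rewrite c0, c1 in Ex; rewrite c0 in Ey; nra.
Qed.

End Minkowski.

(** * The billiard table *)

Lemma strictly_convex_chord (Q : R * R -> Prop) (x y : R * R) (t : R) :
  strictly_convex_domain Q -> closure Q x -> closure Q y -> x <> y -> 0 < t < 1 ->
  Q ((1 - t) * fst x + t * fst y, (1 - t) * snd x + t * snd y).
Proof. intros HQ Hx Hy Hn Ht; exact (scd_convex Q HQ x y t Hx Hy Hn Ht). Qed.

Lemma domain_closure (Q : R * R -> Prop) (x : R * R) : Q x -> closure Q x.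
Proof. intros H K; exact (locally_singleton _ _ K H). Qed.

Lemma boundary_not_domain (Q : R * R -> Prop) (x : R * R) :
  strictly_convex_domain Q -> boundary Q x -> ~ Q x.
Proof. intros HQ [_ H] K; exact (H (scd_open Q HQ x K)). Qed.

Lemma chord_points_inside (Q : R * R -> Prop) (x y : R * R) (k : R) :
  strictly_convex_domain Q -> closure Q x -> closure Q y -> x <> y -> 0 < k ->
  points_inside Q x (k * (fst y - fst x), k * (snd y - snd x)).
Proof.
  intros HQ Hx Hy Hn Hk; exists (/ k); split; [now apply Rinv_0_lt_compat |].
  intros t [Ht0 Ht].
  assert (Hkt : t * k < 1).
  { apply (Rmult_lt_compat_r k) in Ht; [| exact Hk]; rewrite Rinv_l in Ht; lra. }
  replace (plus x _) with
    ((1 - t * k) * fst x + (t * k) * fst y, (1 - t * k) * snd x + (t * k) * snd y).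
  - apply strictly_convex_chord; try assumption; split; [nra | exact Hkt].
  - destruct x, y; unfold plus, scal; simpl; unfold prod_plus, prod_scal, scal; simpl.
    unfold plus, mult; simpl; f_equal; ring.
Qed.

(** A chord is never tangent to the boundary at its endpoint [g s]: otherwise the
    boundary would enter, near [g s], the cone that joins [g s] to a
    neighbourhood of the midpoint of the chord, and this cone lies in [Q]. *)
Lemma chord_transversal (Q : R * R -> Prop) (g : R -> R * R) (s : R) (a y : R * R) :
  strictly_convex_domain Q -> (forall r, boundary Q (g r)) ->
  is_derive (fun r => fst (g r)) s (fst a) ->
  is_derive (fun r => snd (g r)) s (snd a) ->
  a <> (0, 0) -> closure Q y -> y <> g s ->
  area_form (fst y - fst (g s), snd y - snd (g s)) a <> 0.
Proof.
  intros HQ Hb H1 H2 Ha Hy Hn E.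
  set (x := g s) in *.
  set (v1 := fst y - fst x) in *. set (v2 := snd y - snd x) in *.
  unfold area_form in E; simpl in E.
  assert (Hv : 0 < v1 * v1 + v2 * v2).
  { destruct (Req_dec v1 0) as [Z1 | Z1]; [| nra].
    destruct (Req_dec v2 0) as [Z2 | Z2]; [| nra].
    elim Hn; unfold v1, v2 in *; destruct x, y; simpl in *; f_equal; lra. }
  set (c := (fst a * v1 + snd a * v2) / (v1 * v1 + v2 * v2)).
  assert (A1 : fst a = c * v1).
  { apply Rmult_eq_reg_r with (v1 * v1 + v2 * v2); [| lra].
    unfold c; field_simplify; [| lra].
    replace (fst a * v2 ^ 2) with (v2 * (v2 * fst a)) by ring.
    replace (v2 * fst a) with (v1 * snd a) by lra; ring. }
  assert (A2 : snd a = c * v2).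
  { apply Rmult_eq_reg_r with (v1 * v1 + v2 * v2); [| lra].
    unfold c; field_simplify; [| lra].
    replace (snd a * v1 ^ 2) with (v1 * (v1 * snd a)) by ring.
    replace (v1 * snd a) with (v2 * fst a) by lra; ring. }
  assert (Hc : c <> 0).
  { intros Z; apply Ha; rewrite (surjective_pairing a), A1, A2, Z; f_equal; ring. }
  assert (Hx : closure Q x) by apply (Hb s).
  assert (Hnx : ~ Q x) by apply (boundary_not_domain Q _ HQ (Hb s)).
  assert (Hm := strictly_convex_chord Q x y (/ 2) HQ Hx Hy (not_eq_sym Hn) ltac:(lra)).
  destruct (scd_open Q HQ _ Hm) as [d Hd].
  assert (Hcd : 0 < 2 * Rabs c * d).
  { apply Rmult_lt_0_compat; [| apply cond_pos].
    apply Rmult_lt_0_compat; [lra | now apply Rabs_pos_lt]. }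
  destruct (proj1 (is_derive_Reals _ _ _) H1 _ Hcd) as [d1 N1].
  destruct (proj1 (is_derive_Reals _ _ _) H2 _ Hcd) as [d2 N2].
  assert (Hc' : 0 < Rabs c) by now apply Rabs_pos_lt.
  (* [g (s + h) = (1 - t) x + t z] with [z] close to the midpoint *)
  assert (Ht : exists t, 0 < t < 1 /\ t / (2 * Rabs c) < Rmin d1 d2).
  { assert (Hmin : 0 < Rmin d1 d2) by (apply Rmin_pos; apply cond_pos).
    exists (Rmin (/ 2) (Rabs c * Rmin d1 d2)).
    assert (0 < Rabs c * Rmin d1 d2) by now apply Rmult_lt_0_compat.
    assert (M1 := Rmin_l (/ 2) (Rabs c * Rmin d1 d2)).
    assert (M2 := Rmin_r (/ 2) (Rabs c * Rmin d1 d2)).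
    repeat split; [apply Rmin_pos; lra | lra |].
    apply Rmult_lt_reg_r with (2 * Rabs c); [lra |].
    unfold Rdiv; rewrite Rmult_assoc, Rinv_l by lra; nra. }
  destruct Ht as [t [[Ht0 Ht1] Ht]].
  assert (Hm1 := Rmin_l d1 d2). assert (Hm2 := Rmin_r d1 d2).
  set (h := t / (2 * c)).
  assert (Hh : h <> 0).
  { unfold h; apply Rmult_integral_contrapositive; split; [lra |].
    apply Rinv_neq_0_compat; lra. }
  assert (Hha : Rabs h = t / (2 * Rabs c)).
  { unfold h, Rdiv; rewrite Rabs_mult, Rabs_inv, Rabs_mult.
    rewrite (Rabs_pos_eq t), (Rabs_pos_eq 2) by lra; reflexivity. }
  assert (K : forall X X' al v : R, al = c * v ->
    Rabs ((X' - X) / h - al) < 2 * Rabs c * d ->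
    Rabs ((X + (X' - X) / t) - ((1 - / 2) * X + / 2 * (X + v))) < d).
  { intros X X' al v Eal B.
    replace (X + (X' - X) / t - ((1 - / 2) * X + / 2 * (X + v))) with
      (((X' - X) / h - al) * / (2 * c))
      by (rewrite Eal; unfold h; field; lra).
    rewrite Rabs_mult, Rabs_inv, Rabs_mult, (Rabs_pos_eq 2) by lra.
    apply Rmult_lt_reg_r with (2 * Rabs c); [lra |].
    rewrite Rmult_assoc, Rinv_l by lra; lra. }
  set (z := (fst x + (fst (g (s + h)) - fst x) / t,
             snd x + (snd (g (s + h)) - snd x) / t)).
  assert (Hz : Q z).
  { apply Hd; split; simpl.
    - replace (fst y) with (fst x + v1) by (unfold v1; ring).
      apply (K _ _ _ _ A1), N1; [exact Hh | lra].
    - replace (snd y) with (snd x + v2) by (unfold v2; ring).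
      apply (K _ _ _ _ A2), N2; [exact Hh | lra]. }
  apply (boundary_not_domain Q _ HQ (Hb (s + h))).
  replace (g (s + h)) with
    ((1 - t) * fst x + t * fst z, (1 - t) * snd x + t * snd z).
  - apply strictly_convex_chord; try assumption; [now apply domain_closure | | lra].
    intros Exz; apply Hnx; now rewrite Exz.
  - unfold z; rewrite (surjective_pairing (g (s + h))); simpl; f_equal; field; lra.
Qed.

Lemma smooth_near_locally (g : R -> R * R) (s : R) :
  smooth_near g s -> locally s (smooth_near g).
Proof. apply locally_locally. Qed.

Lemma smooth_near_derive (g : R -> R * R) (s : R) : smooth_near g s ->
  is_derive (fun t => fst (g t)) s (fst (curve_deriv 1 g s)) /\
  is_derive (fun t => snd (g t)) s (snd (curve_deriv 1 g s)).
Proof.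
  intros H; destruct (locally_singleton _ _ H 1%nat) as [H1 H2].
  split; apply Derive_correct; assumption.
Qed.

Lemma smooth_near_derive2 (g : R -> R * R) (s : R) : smooth_near g s ->
  is_derive (fun t => fst (curve_deriv 1 g t)) s (fst (curve_deriv 2 g s)) /\
  is_derive (fun t => snd (curve_deriv 1 g t)) s (snd (curve_deriv 2 g s)).
Proof.
  intros H; destruct (locally_singleton _ _ H 2%nat) as [H1 H2].
  split; apply Derive_correct; assumption.
Qed.

(** * The billiard map *)

(** The partial derivatives of the chord length [ell F g s t]: [- chord_out] is
    the one in [s], that is the coordinate [u], and [chord_in] the one in [t]. *)
Definition chord_out (F : R * R -> R) (g : R -> R * R) (s t : R) : R :=
  grad_sum F (minus (g t) (g s)) (curve_deriv 1 g s).

Definition chord_in (F : R * R -> R) (g : R -> R * R) (s t : R) : R :=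
  grad_sum F (minus (g t) (g s)) (curve_deriv 1 g t).

Lemma minus_pair (x y : R * R) : minus x y = (fst x - fst y, snd x - snd y).
Proof. reflexivity. Qed.

Lemma minus_nonzero (x y : R * R) : x <> y -> minus x y <> (0, 0).
Proof.
  rewrite minus_pair; intros H E; injection E as E1 E2; apply H.
  destruct x, y; simpl in *; f_equal; lra.
Qed.

Section Billiard.

Variables (F : R * R -> R) (Q : R * R -> Prop) (g : R -> R * R) (L : R).
Hypothesis HF : minkowski_norm F.
Hypothesis HQ : strictly_convex_domain Q.
Hypothesis Hg : ccw_arclength_boundary F Q g L.

Let HFs : smooth_off_origin F := mn_smooth F HF.

Lemma boundary_param (s : R) : boundary Q (g s).
Proof. apply (cab_range F Q g L Hg); now exists s. Qed.

Lemma curve_deriv_nonzero (s : R) : smooth_near g s -> curve_deriv 1 g s <> (0, 0).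
Proof.
  intros Hs E; assert (K := cab_unit F Q g L Hg s Hs).
  rewrite E, (minkowski_norm_0 F HF) in K; lra.
Qed.

Lemma is_derive_ell_out (s t : R) : smooth_near g s -> g t <> g s ->
  is_derive (fun r => ell F g r t) s (- chord_out F g s t).
Proof.
  intros Hs Hn; destruct (smooth_near_derive g s Hs) as [H1 H2].
  unfold ell, chord_out; rewrite <- (Ropp_involutive (- _)).
  evar_last.
  - apply (is_derive_comp_curve F HFs (fun r => minus (g t) (g r))
      (- fst (curve_deriv 1 g s), - snd (curve_deriv 1 g s))).
    + now apply minus_nonzero.
    + evar_last; [apply @is_derive_minus; [apply @is_derive_const | exact H1] |].
      unfold minus, plus, opp, zero; simpl; ring.
    + evar_last; [apply @is_derive_minus; [apply @is_derive_const | exact H2] |].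
      unfold minus, plus, opp, zero; simpl; ring.
  - unfold grad_sum; cbn [fst snd]; ring.
Qed.

Lemma is_derive_ell_in (s t : R) : smooth_near g t -> g t <> g s ->
  is_derive (fun r => ell F g s r) t (chord_in F g s t).
Proof.
  intros Ht Hn; destruct (smooth_near_derive g t Ht) as [H1 H2].
  unfold ell, chord_in.
  apply (is_derive_comp_curve F HFs (fun r => minus (g r) (g s))).
  - now apply minus_nonzero.
  - evar_last; [apply @is_derive_minus; [exact H1 | apply @is_derive_const] |].
    unfold minus, plus, opp, zero; simpl; ring.
  - evar_last; [apply @is_derive_minus; [exact H2 | apply @is_derive_const] |].
    unfold minus, plus, opp, zero; simpl; ring.
Qed.

Lemma u_coord_chord_out (s t : R) : smooth_near g s -> g t <> g s ->
  u_coord F g s t = - chord_out F g s t.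
Proof. intros Hs Hn; now apply is_derive_unique, is_derive_ell_out. Qed.

Lemma chord_transversal_out (s t : R) : smooth_near g s -> g t <> g s ->
  area_form (minus (g t) (g s)) (curve_deriv 1 g s) <> 0.
Proof.
  intros Hs Hn; destruct (smooth_near_derive g s Hs) as [H1 H2].
  rewrite minus_pair.
  apply (chord_transversal Q g s); try assumption.
  - exact boundary_param.
  - now apply curve_deriv_nonzero.
  - apply boundary_param.
Qed.

Lemma chord_transversal_in (s t : R) : smooth_near g t -> g t <> g s ->
  area_form (minus (g t) (g s)) (curve_deriv 1 g t) <> 0.
Proof.
  intros Ht Hn E; apply (chord_transversal_out t s Ht (not_eq_sym Hn)).
  rewrite minus_pair in *; unfold area_form in *; simpl in *; lra.
Qed.

Lemma chord_phase_point (s t : R) : s < t < s + L ->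
  phase_point_from_to F Q g L
    (g s, (/ F (minus (g t) (g s)) * (fst (g t) - fst (g s)),
           / F (minus (g t) (g s)) * (snd (g t) - snd (g s)))) s t.
Proof.
  intros Hst.
  assert (Hn := cab_inj F Q g L Hg s t Hst).
  assert (HFv := minkowski_norm_pos F HF _ (minus_nonzero _ _ (not_eq_sym Hn))).
  assert (HFi := Rinv_0_lt_compat _ HFv).
  split; [split; [| split] | split; [exact Hst | split; [reflexivity |]]];
    cbn [fst snd].
  - apply boundary_param.
  - rewrite (minkowski_norm_scal F HF) by exact HFi.
    rewrite <- minus_pair; field; lra.
  - apply chord_points_inside; try assumption; apply boundary_param.
  - exists (F (minus (g t) (g s))); split; [exact HFv |].
    rewrite (surjective_pairing (g t)) at 1.
    rewrite (surjective_pairing (g s)) at 1.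
    set (k := F _) in *.
    unfold plus, scal; simpl; unfold prod_plus, prod_scal, scal; simpl.
    unfold plus, mult; simpl; f_equal; field; lra.
Qed.

(** Every phase point arriving at a smooth boundary point is reflected. As [r]
    runs from [t] to [t + L], the coordinate [- chord_out F g t r] runs from
    [- F w] to [F (- w)], where [w] is the unit tangent at [g t]; the value required
    by the reflection law lies strictly in between because incoming chords are
    transversal to [w]. *)
Lemma reflected_exists (s t : R) : smooth_near g t -> g t <> g s ->
  exists r, t < r < t + L /\ chord_out F g t r = chord_in F g s t.
Proof.
  intros Ht Hn.
  set (a := curve_deriv 1 g t).
  set (c := chord_in F g s t).
  destruct (smooth_near_derive g t Ht) as [H1 H2]; fold a in H1, H2.
  assert (Hv := chord_transversal_in s t Ht Hn); fold a in Hv.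
  assert (Ha : a <> (0, 0)) by now apply curve_deriv_nonzero.
  set (b := (- fst a, - snd a)).
  assert (Hb : b <> (0, 0)).
  { intros E; apply Ha; injection E as E1 E2; apply injective_projections; simpl; lra. }
  assert (Hc1 : c < grad_sum F a a).
  { rewrite (minkowski_norm_euler F HF a Ha); now apply grad_sum_lt. }
  assert (Hc2 : grad_sum F b a < c).
  { assert (K : grad_sum F (minus (g t) (g s)) b < F b).
    { apply grad_sum_lt; [exact HF |].
      unfold area_form, b in *; simpl in *; lra. }
    rewrite <- (minkowski_norm_euler F HF b Hb) in K.
    replace (grad_sum F (minus (g t) (g s)) b) with (- c) in K
      by (unfold c, chord_in, grad_sum, b; simpl; fold a; ring).
    replace (grad_sum F b b) with (- grad_sum F b a) in K
      by (unfold grad_sum, b; simpl; ring).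
    lra. }
  assert (HL := cab_pos F Q g L Hg).
  destruct (grad_sum_short_chord F HF (fun h => g (t + h)) a a (grad_sum F a a - c))
    as [d1 N1]; try assumption; [| | lra |].
  { apply is_derive_Reals; apply is_derive_Reals in H1.
    intros e He; destruct (H1 e He) as [d D]; exists d; intros h Hh0 Hh.
    rewrite Rplus_0_l, Rplus_0_r; now apply D. }
  { apply is_derive_Reals; apply is_derive_Reals in H2.
    intros e He; destruct (H2 e He) as [d D]; exists d; intros h Hh0 Hh.
    rewrite Rplus_0_l, Rplus_0_r; now apply D. }
  assert (Hopp : forall f l, is_derive f t l -> is_derive (fun h => f (t - h)) 0 (- l)).
  { intros f l K; apply is_derive_Reals; apply is_derive_Reals in K.
    intros e He; destruct (K e He) as [d D]; exists d; intros h Hh0 Hh.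
    specialize (D (- h) ltac:(lra)); rewrite Rabs_Ropp in D.
    eapply Rle_lt_trans; [right | exact (D Hh)].
    rewrite <- Rabs_Ropp; f_equal.
    replace (t - (0 + h)) with (t + - h) by ring; rewrite Rminus_0_r.
    field; exact Hh0. }
  destruct (grad_sum_short_chord F HF (fun h => g (t - h)) b a (c - grad_sum F b a))
    as [d2 N2]; try assumption; [| | lra |].
  { exact (Hopp _ _ H1). }
  { exact (Hopp _ _ H2). }
  (* the bound by [L / 4] keeps [t + h] to the left of [t + L - h] *)
  set (h := Rmin (L / 4) (Rmin (d1 / 2) (d2 / 2))).
  assert (Hd1 := cond_pos d1). assert (Hd2 := cond_pos d2).
  assert (Hh : 0 < h) by (unfold h; repeat apply Rmin_pos; lra).
  assert (M1 := Rmin_l (L / 4) (Rmin (d1 / 2) (d2 / 2))).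
  assert (M2 := Rmin_r (L / 4) (Rmin (d1 / 2) (d2 / 2))).
  assert (M3 := Rmin_l (d1 / 2) (d2 / 2)). assert (M4 := Rmin_r (d1 / 2) (d2 / 2)).
  fold h in M1, M2.
  assert (E1 := N1 h ltac:(lra)); assert (E2 := N2 h ltac:(lra)).
  rewrite Rplus_0_r in E1; rewrite Rminus_0_r in E2.
  rewrite <- minus_pair in E1, E2.
  apply Rabs_def2 in E1; apply Rabs_def2 in E2.
  destruct (IVT_interv (fun r => c - chord_out F g t r) (t + h) (t + L - h))
    as [r [Hr Er]].
  - intros r Hr.
    assert (Hnr := cab_inj F Q g L Hg t r ltac:(lra)).
    apply continuity_pt_minus; [apply continuity_pt_const; red; reflexivity |].
    apply continuity_pt_filterlim.
    destruct (cab_smooth F Q g L Hg) as [Cg _].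
    set (w := minus (g r) (g t)).
    assert (Cw := continuity_2d_grad_sum F HF w a (minus_nonzero _ _ (not_eq_sym Hnr))).
    apply continuity_2d_pt_filterlim in Cw.
    unfold chord_out; fold a.
    apply (continuous_comp_2 (fun r => fst (g r) - fst (g t))
      (fun r => snd (g r) - snd (g t)) (fun x y => grad_sum F (x, y) a)).
    + apply (continuous_minus (fun r => fst (g r)) (fun _ => fst (g t)));
        [apply continuous_comp; [apply Cg | apply continuous_fst]
        | apply continuous_const].
    + apply (continuous_minus (fun r => snd (g r)) (fun _ => snd (g t)));
        [apply continuous_comp; [apply Cg | apply continuous_snd]
        | apply continuous_const].
    + exact Cw.
  - lra.
  - unfold chord_out; fold a; lra.
  - replace (g (t - h)) with (g (t + L - h)) in E2.
    + unfold chord_out; fold a; lra.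
    + rewrite <- (proj1 (proj2 (cab_smooth F Q g L Hg)) (t - h)); f_equal; ring.
  - exists r; split; lra.
Qed.

(** By the reflection law, the image of a phase point is determined by the chord
    that it follows. *)
Lemma billiard_map_value (T : R * R -> R * R) (s t : R) :
  is_billiard_map F Q g L T -> smooth_near g s -> smooth_near g t ->
  s < t < s + L -> T (s, - chord_out F g s t) = (t, - chord_in F g s t).
Proof.
  intros HT Hs Ht Hst.
  assert (Hn := not_eq_sym (cab_inj F Q g L Hg s t Hst)).
  destruct (reflected_exists s t Ht Hn) as [r [Hr Er]].
  assert (Hnr := not_eq_sym (cab_inj F Q g L Hg t r Hr)).
  rewrite <- Er, <- (u_coord_chord_out s t Hs Hn), <- (u_coord_chord_out t r Ht Hnr).
  apply (HT _ _ s t r Hs Ht (chord_phase_point s t Hst) (chord_phase_point t r Hr)).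
  unfold reflected.
  replace 0 with (chord_in F g s t + - chord_out F g t r) by lra.
  apply is_derive_Rplus; [now apply is_derive_ell_in | now apply is_derive_ell_out].
Qed.

(** Product and chain rules for [grad_sum F (v x y) (b x y)]; [vs], [vt], [bs],
    [bt] are the partial derivatives of [v] and [b]. *)
Lemma differentiable_grad_sum (v b : R -> R -> R * R) (s t : R)
    (vs vt bs bt : R * R) :
  v s t <> (0, 0) ->
  differentiable_pt_lim (fun x y => fst (v x y)) s t (fst vs) (fst vt) ->
  differentiable_pt_lim (fun x y => snd (v x y)) s t (snd vs) (snd vt) ->
  differentiable_pt_lim (fun x y => fst (b x y)) s t (fst bs) (fst bt) ->
  differentiable_pt_lim (fun x y => snd (b x y)) s t (snd bs) (snd bt) ->
  differentiable_pt_lim (fun x y => grad_sum F (v x y) (b x y)) s t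
    (grad_sum F (v s t) bs + hess_sum F (v s t) (b s t) vs)
    (grad_sum F (v s t) bt + hess_sum F (v s t) (b s t) vt).
Proof.
  intros Hv V1 V2 B1 B2.
  assert (K : forall f : R * R -> R, smooth_off_origin f ->
    differentiable_pt_lim (fun x y => f (v x y)) s t
      (grad_sum f (v s t) vs) (grad_sum f (v s t) vt)).
  { intros f Hf.
    apply differentiable_pt_lim_ext with (fun x y => f (fst (v x y), snd (v x y))).
    - apply locally_2d_forall; intros x y; now rewrite <- surjective_pairing.
    - apply (differentiable_pt_lim_comp (fun x y => f (x, y)));
        [now apply smooth_off_origin_differentiable | assumption..]. }
  assert (K1 := K _ (smooth_off_origin_D1 F HFs)).
  assert (K2 := K _ (smooth_off_origin_D2 F HFs)).
  eapply differentiable_pt_lim_value.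
  - apply (differentiable_pt_lim_plus (fun x y => D1 F (v x y) * fst (b x y))
      (fun x y => D2 F (v x y) * snd (b x y)));
      apply (differentiable_pt_lim_mult (fun x y => _ (v x y)) (fun x y => _ (b x y)));
      eassumption.
  - unfold grad_sum, hess_sum; ring.
  - unfold grad_sum, hess_sum; ring.
Qed.

Lemma differentiable_chord (s t : R) : smooth_near g s -> smooth_near g t ->
  differentiable_pt_lim (fun x y => fst (minus (g y) (g x))) s t
    (- fst (curve_deriv 1 g s)) (fst (curve_deriv 1 g t)) /\
  differentiable_pt_lim (fun x y => snd (minus (g y) (g x))) s t
    (- snd (curve_deriv 1 g s)) (snd (curve_deriv 1 g t)).
Proof.
  intros Hs Ht.
  destruct (smooth_near_derive g s Hs) as [S1 S2].
  destruct (smooth_near_derive g t Ht) as [T1 T2].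
  rewrite is_derive_Reals in S1, S2, T1, T2.
  split.
  - eapply differentiable_pt_lim_value;
      [apply (differentiable_pt_lim_plus (fun x y => fst (g y)) (fun x y => - fst (g x)));
        [apply (differentiable_pt_lim_proj2_0 (fun y => fst (g y))), T1
        | apply differentiable_pt_lim_opp,
            (differentiable_pt_lim_proj1_0 (fun x => fst (g x))), S1]
      | ring..].
  - eapply differentiable_pt_lim_value;
      [apply (differentiable_pt_lim_plus (fun x y => snd (g y)) (fun x y => - snd (g x)));
        [apply (differentiable_pt_lim_proj2_0 (fun y => snd (g y))), T2
        | apply differentiable_pt_lim_opp,
            (differentiable_pt_lim_proj1_0 (fun x => snd (g x))), S2]
      | ring..].
Qed.

Lemma differentiable_chord_out (s t : R) :
  smooth_near g s -> smooth_near g t -> g t <> g s ->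
  let v := minus (g t) (g s) in
  let dg := curve_deriv 1 g in
  let ddg := curve_deriv 2 g in
  differentiable_pt_lim (fun x y => - chord_out F g x y) s t
    (hess_sum F v (dg s) (dg s) - grad_sum F v (ddg s))
    (- hess_sum F v (dg s) (dg t)).
Proof.
  intros Hs Ht Hn v dg ddg.
  destruct (differentiable_chord s t Hs Ht) as [V1 V2].
  destruct (smooth_near_derive2 g s Hs) as [S1 S2].
  rewrite is_derive_Reals in S1, S2.
  eapply differentiable_pt_lim_value.
  - apply differentiable_pt_lim_opp.
    apply (differentiable_grad_sum (fun x y => minus (g y) (g x)) (fun x y => dg x) s t
      (- fst (dg s), - snd (dg s)) (dg t) (ddg s) (0, 0));
      [now apply minus_nonzero | exact V1 | exact V2 | |].
    + apply (differentiable_pt_lim_proj1_0 (fun x => fst (dg x))), S1.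
    + apply (differentiable_pt_lim_proj1_0 (fun x => snd (dg x))), S2.
  - fold v; unfold grad_sum, hess_sum; cbn [fst snd]; ring.
  - fold v; unfold grad_sum, hess_sum; cbn [fst snd]; ring.
Qed.

Lemma differentiable_chord_in (s t : R) :
  smooth_near g s -> smooth_near g t -> g t <> g s ->
  let v := minus (g t) (g s) in
  let dg := curve_deriv 1 g in
  let ddg := curve_deriv 2 g in
  differentiable_pt_lim (fun x y => - chord_in F g x y) s t
    (hess_sum F v (dg t) (dg s))
    (- (hess_sum F v (dg t) (dg t) + grad_sum F v (ddg t))).
Proof.
  intros Hs Ht Hn v dg ddg.
  destruct (differentiable_chord s t Hs Ht) as [V1 V2].
  destruct (smooth_near_derive2 g t Ht) as [T1 T2].
  rewrite is_derive_Reals in T1, T2.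
  eapply differentiable_pt_lim_value.
  - apply differentiable_pt_lim_opp.
    apply (differentiable_grad_sum (fun x y => minus (g y) (g x)) (fun x y => dg y) s t
      (- fst (dg s), - snd (dg s)) (dg t) (0, 0) (ddg t));
      [now apply minus_nonzero | exact V1 | exact V2 | |].
    + apply (differentiable_pt_lim_proj2_0 (fun x => fst (dg x))), T1.
    + apply (differentiable_pt_lim_proj2_0 (fun x => snd (dg x))), T2.
  - fold v; unfold grad_sum, hess_sum; cbn [fst snd]; ring.
  - fold v; unfold grad_sum, hess_sum; cbn [fst snd]; ring.
Qed.

Lemma smooth_chords_locally (s t : R) :
  smooth_near g s -> smooth_near g t -> s < t < s + L ->
  locally_2d (fun x y => smooth_near g x /\ smooth_near g y /\ x < y < x + L) s t.
Proof.
  intros Hs Ht Hst.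
  destruct (smooth_near_locally g s Hs) as [d1 N1].
  destruct (smooth_near_locally g t Ht) as [d2 N2].
  set (d := Rmin (Rmin d1 d2) (Rmin ((t - s) / 2) ((s + L - t) / 2))).
  assert (Hd : 0 < d) by (unfold d; repeat apply Rmin_pos; try apply cond_pos; lra).
  assert (M1 := Rmin_l (Rmin d1 d2) (Rmin ((t - s) / 2) ((s + L - t) / 2))).
  assert (M2 := Rmin_r (Rmin d1 d2) (Rmin ((t - s) / 2) ((s + L - t) / 2))).
  assert (M3 := Rmin_l d1 d2). assert (M4 := Rmin_r d1 d2).
  assert (M5 := Rmin_l ((t - s) / 2) ((s + L - t) / 2)).
  assert (M6 := Rmin_r ((t - s) / 2) ((s + L - t) / 2)).
  fold d in M1, M2.
  exists (mkposreal d Hd); simpl; intros x y Hx Hy.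
  split; [| split].
  - apply N1; change (Rabs (x - s) < d1); lra.
  - apply N2; change (Rabs (y - t) < d2); lra.
  - apply Rabs_def2 in Hx; apply Rabs_def2 in Hy; lra.
Qed.

(** The differential of the billiard map, in terms of those of [- chord_out]
    (coefficients [a], [b]) and [- chord_in] (coefficients [c], [d]). *)
Lemma differentiable_billiard_map (T : R * R -> R * R) (s t a b c d : R) :
  is_billiard_map F Q g L T -> smooth_near g s -> smooth_near g t ->
  s < t < s + L ->
  differentiable_pt_lim (fun x y => - chord_out F g x y) s t a b -> b <> 0 ->
  differentiable_pt_lim (fun x y => - chord_in F g x y) s t c d ->
  let u := - chord_out F g s t in
  differentiable_pt_lim (fun x y => fst (T (x, y))) s u (- a / b) (/ b) /\
  differentiable_pt_lim (fun x y => snd (T (x, y))) s u (c + d * (- a / b)) (d / b).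
Proof.
  intros HT Hs Ht Hst HU Hb HW u.
  destruct (smooth_chords_locally s t Hs Ht Hst) as [d0 D0].
  (* [phi s' u'] is the parameter of the next impact *)
  set (phi := fun x y => fst (T (x, y))).
  destruct (differentiable_pt_lim_implicit (fun x y => - chord_out F g x y) phi s t a b
    HU Hb) as [K1 K2].
  { exists d0; intros x y Hx Hy.
    destruct (D0 x y Hx Hy) as [Sx [Sy Hxy]].
    assert (Hn := not_eq_sym (cab_inj F Q g L Hg x y Hxy)).
    split.
    - apply continuity_pt_filterlim.
      assert (C := differentiable_pt_lim_continuity _ _ _ _ _
        (differentiable_chord_out x y Sx Sy Hn)).
      intros P [e He].
      destruct (C e) as [e' He']; exists e'; intros y' Hy'.
      apply He, He'; [rewrite Rminus_diag, Rabs_R0; apply cond_pos | exact Hy'].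
    - unfold phi; now rewrite (billiard_map_value T x y HT Sx Sy Hxy). }
  fold u in K1, K2.
  split; [exact K1 |].
  assert (E0 : phi s u = t)
    by (unfold phi, u; now rewrite (billiard_map_value T s t HT Hs Ht Hst)).
  assert (Id : differentiable_pt_lim (fun x _ => x) s u 1 0)
    by apply (differentiable_pt_lim_proj1_0 (fun x => x)), derivable_pt_lim_id.
  apply differentiable_pt_lim_ext with (fun x y => - chord_in F g x (phi x y)).
  - assert (C := differentiable_pt_lim_continuity _ _ _ _ _ K1 d0).
    destruct C as [d1 C]. destruct K2 as [d2 K2].
    assert (Hd : 0 < Rmin d0 (Rmin d1 d2)) by (repeat apply Rmin_pos; apply cond_pos).
    assert (M1 := Rmin_l d0 (Rmin d1 d2)). assert (M2 := Rmin_r d0 (Rmin d1 d2)).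
    assert (M3 := Rmin_l d1 d2). assert (M4 := Rmin_r d1 d2).
    exists (mkposreal _ Hd); simpl; intros x y Hx Hy.
    assert (Cxy := C x y ltac:(lra) ltac:(lra)); rewrite E0 in Cxy.
    destruct (D0 x (phi x y) ltac:(lra) Cxy) as [Sx [Sy Hxy]].
    assert (V := billiard_map_value T x (phi x y) HT Sx Sy Hxy).
    rewrite (K2 x y ltac:(lra) ltac:(lra)) in V; now rewrite V.
  - eapply differentiable_pt_lim_value.
    + apply (differentiable_pt_lim_comp (fun x y => - chord_in F g x y) (fun x _ => x) phi);
        [rewrite E0; exact HW | exact Id | exact K1].
    + ring.
    + unfold Rdiv; ring.
Qed.

End Billiard.

Theorem proposition3p4 (F : R * R -> R) (Q : R * R -> Prop)
    (g : R -> R * R) (L : R) (T : R * R -> R * R)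
    (hF : minkowski_norm F)
    (hQ : strictly_convex_domain Q)
    (hg : ccw_arclength_boundary F Q g L)
    (hT : is_billiard_map F Q g L T)
    (p : (R * R) * (R * R)) (s s1 : R)
    (hp : phase_point_from_to F Q g L p s s1)
    (hs : smooth_near g s) (hs1 : smooth_near g s1) :
  let u := u_coord F g s s1 in
  let v := minus (g s1) (g s) in
  let dg := curve_deriv 1 g in
  let ddg := curve_deriv 2 g in
  preserves_area_form_at T (s, u) /\
  hess_sum F v (dg s) (dg s1) <> 0 /\
  D1 (fun q => fst (T q)) (s, u) =
    (hess_sum F v (dg s) (dg s) - grad_sum F v (ddg s))
      / hess_sum F v (dg s) (dg s1) /\
  D2 (fun q => fst (T q)) (s, u) =
    - 1 / hess_sum F v (dg s) (dg s1) /\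
  D1 (fun q => snd (T q)) (s, u) =
    hess_sum F v (dg s1) (dg s)
    - (hess_sum F v (dg s1) (dg s1) + grad_sum F v (ddg s1))
      * ((hess_sum F v (dg s) (dg s) - grad_sum F v (ddg s))
           / hess_sum F v (dg s) (dg s1)) /\
  D2 (fun q => snd (T q)) (s, u) =
    (hess_sum F v (dg s1) (dg s1) + grad_sum F v (ddg s1))
      / hess_sum F v (dg s) (dg s1).
Proof.
  intros u v dg ddg.
  destruct hp as [_ [Hst _]].
  assert (Hn := not_eq_sym (cab_inj F Q g L hg s s1 Hst)).
  set (B := hess_sum F v (dg s) (dg s1)).
  assert (HB : B <> 0).
  { apply (hess_sum_nonzero F hF).
    - now apply (chord_transversal_out F Q g L).
    - now apply (chord_transversal_in F Q g L). }
  assert (Hu : u = - chord_out F g s s1) by now apply u_coord_chord_out.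
  destruct (differentiable_billiard_map F Q g L hF hQ hg T s s1 _ _ _ _ hT hs hs1 Hst
    (differentiable_chord_out F g hF s s1 hs hs1 Hn) (Ropp_neq_0_compat _ HB)
    (differentiable_chord_in F g hF s s1 hs hs1 Hn)) as [K1 K2].
  rewrite <- Hu in K1, K2.
  fold v dg ddg B in K1, K2.
  set (A := hess_sum F v (dg s) (dg s) - grad_sum F v (ddg s)) in *.
  set (C := hess_sum F v (dg s1) (dg s1) + grad_sum F v (ddg s1)) in *.
  destruct (differentiable_pt_lim_unique _ _ _ _ _ K1) as [E1 E2].
  destruct (differentiable_pt_lim_unique _ _ _ _ _ K2) as [E3 E4].
  assert (Hsym : hess_sum F v (dg s1) (dg s) = B)
    by (apply (hess_sum_sym F hF); now apply minus_nonzero).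
  assert (F1 : D1 (fun q => fst (T q)) (s, u) = A / B)
    by (eapply eq_trans; [exact E1 | field; exact HB]).
  assert (F2 : D2 (fun q => fst (T q)) (s, u) = - 1 / B)
    by (eapply eq_trans; [exact E2 | field; exact HB]).
  assert (F3 : D1 (fun q => snd (T q)) (s, u) =
            hess_sum F v (dg s1) (dg s) - C * (A / B))
    by (eapply eq_trans; [exact E3 | field; exact HB]).
  assert (F4 : D2 (fun q => snd (T q)) (s, u) = C / B)
    by (eapply eq_trans; [exact E4 | field; exact HB]).
  split; [| now repeat split].
  split; [split; eexists; eexists; [exact K1 | exact K2] |].
  intros X Y; unfold area_form, tangent_map, grad_sum; cbn [fst snd].
  (* the Jacobian determinant is the ratio of the two mixed Hessian terms *)
  rewrite F1, F2, F3, F4, Hsym; field; exact HB.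
Qed.
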